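(* For all $u\in\mathcal E_1$ (that is, all $u\in H^1_{r,0}$ with $\mathcal E(u)\le2$) the following holds: $$\|u\|_{L^\infty(I)}\le2\arcsin\sqrt{\tfrac12\,\mathcal E(u)} .$$
   Context: $I=[0,1]$. $\|v\|_{0,r}^2=\int_0^1 v(r)^2\,r\,dr$ and $\|v\|_{H^1_r}^2=\|\partial_r v\|_{0,r}^2+\left\|\frac vr\right\|_{0,r}^2$. $H^1_{r,0}=\{v:I\to\mathbb R:\ \|v\|_{0,r}<\infty,\ \|v\|_{H^1_r}<\infty,\ v(0)=v(1)=0\}$ (with $\partial_r v$ the weak derivative and point values those of the continuous representative). The energy is $\mathcal E(v)=\frac12\int_0^1\left((\partial_r v)^2+\frac{\sin^2 v}{r^2}\right)r\,dr$. For $b>0$, $\mathcal E_b=\{v\in H^1_{r,0}:\ \mathcal E(v)\le2b\}$. *)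

(* Defs.v *)
From mathcomp Require Import all_boot all_order all_algebra.
From mathcomp Require Import all_classical all_reals all_analysis.

Set Implicit Arguments.
Unset Strict Implicit.
Unset Printing Implicit Defensive.

Import Order.TTheory GRing.Theory Num.Theory.
Import numFieldNormedType.Exports.

Local Open Scope classical_set_scope.
Local Open Scope ring_scope.

(* A function on I = [0,1] is encoded as a total function R -> R; the norms,
   the weak derivative and the energy depend only on its values on [0,1]. *)
Section radial_space.
Context {R : realType}.
Local Notation mu := (@lebesgue_measure R).
Implicit Types (v w g phi : R -> R).

Definition test_function phi : Prop :=
  (forall (n : nat) (x : R), derivable (derive1n n phi) x 1) /\
  exists K : set R,
    [/\ compact K, K `<=` `]0, 1[ & forall x, ~ K x -> phi x = 0].

Definition is_weak_derivative v g : Prop :=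
  [/\ locally_integrable `]0, 1[%classic v,
      locally_integrable `]0, 1[%classic g &
      forall phi, test_function phi ->
        \int[mu]_(r in `]0, 1[) (v r * derive1 phi r) =
        - \int[mu]_(r in `]0, 1[) (g r * phi r)].

Definition weakly_differentiable v : Prop := exists g, is_weak_derivative v g.

(* Weak derivatives are unique only up to null sets: weak_derivative v is one
   fixed choice, and is the zero function if v has no weak derivative. It is
   only used under integrals over [0,1], where the choice does not matter. *)
Definition weak_derivative v : R -> R := xget (cst 0) (is_weak_derivative v).

Definition norm0r v : \bar R :=
  sqrte (\int[mu]_(r in `[0%R, 1%R]) (v r ^+ 2 * r)%:E)%E.

Definition normH1r v : \bar R :=
  sqrte (norm0r (weak_derivative v) ^+ 2 +
         norm0r (fun r => (v r / r)%R) ^+ 2)%E.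

Definition continuous_representative v w : Prop :=
  {within `[0, 1], continuous w} /\
  {ae mu, forall r, `[0, 1]%classic r -> v r = w r}.

(* Two functions equal a.e. on [0,1] are the same element of the space, so the
   boundary values are read off the continuous representative, which is unique
   on [0,1]. *)
Definition H1r0 : set (R -> R) := [set v : R -> R |
  [/\ measurable_fun (`[0, 1]%classic : set R) v,
      weakly_differentiable v,
      (norm0r v < +oo)%E,
      (normH1r v < +oo)%E &
      exists w, [/\ continuous_representative v w, w 0 = 0 & w 1 = 0]]].

Definition energy v : \bar R :=
  ((2^-1)%:E * \int[mu]_(r in `[0%R, 1%R])
     ((weak_derivative v r ^+ 2 + sin (v r) ^+ 2 / r ^+ 2) * r)%:E)%E.

Definition energy_sublevel (b : R) : set (R -> R) :=
  [set v : R -> R | H1r0 v /\ (energy v <= (2 * b)%:E)%E].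

Definition norm_Linfty v : \bar R :=
  ('N[mrestr mu (measurable_itv `[0%R, 1%R])]_+oo[EFin \o v])%E.

End radial_space.

(* Main.v *)
Require Import Defs.
From mathcomp Require Import all_boot all_order all_algebra.
From mathcomp Require Import all_classical all_reals all_analysis.
From mathcomp Require Import measurable_realfun ess_sup_inf.
From mathcomp Require Import ring lra.

Set Implicit Arguments.
Unset Strict Implicit.
Unset Printing Implicit Defensive.

Import Order.TTheory GRing.Theory Num.Theory.
Import numFieldNormedType.Exports.

Local Open Scope classical_set_scope.
Local Open Scope ring_scope.

(** This is Bogomolny's trick. Completing the square gives, for r > 0,
      |sin u| |u'| <= ((u')^2 + sin^2 u / r^2) r / 2,
    that is, the energy density dominates |(cos u)'|. So the energy spent on
    an interval is at least the variation of cos u there. Let w be the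
    continuous representative of u. Since cos w = 1 at both ends of [0,1], at
    any point x each of the two intervals [0,x] and [x,1] costs at least
    1 - cos w(x), whence 2 (1 - cos w(x)) <= E(u)  [one_sub_cos_le_energy].

    As E(u) <= 2, this keeps cos w >= 0 on [0,1], so the continuous function
    |w|, which starts from 0, never leaves [0, pi/2]. On that range
    1 - cos w = 2 sin^2(|w|/2) can be inverted by asin. The resulting bound
    sin^2(|w|/2) <= E(u)/4 is better than the claimed E(u)/2 by a factor 2;
    counting both intervals is what settles the borderline case E(u) = 2,
    where the estimate on [0,x] alone would not stop w from crossing pi
    [norm_le_asin].

    The analytic content is the passage from the weak derivative g of u to
    variations of cos w. It has two steps.

    - w(b) - w(a) is the integral of g over ]a,b] for 0 < a < b < 1
      [weak_derivative_antiderivative]. The weak derivative is tested against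
      smooth plateaus that converge pointwise to the indicator of ]a,b]; their
      derivatives are approximate Dirac masses at a and b, which evaluate the
      continuous function w. The plateaus are built from the flat function
      exp(-1/x).

    - |cos w(b) - cos w(a)| is at most the integral of |sin w| |g|
      [cos_increment_le_eps, cos_increment_le]. By the mean value theorem this
      holds on short intervals up to an error eps |g|, because w oscillates
      little there; short intervals are glued by a least upper bound argument
      [local_to_global], and eps then tends to 0. *)

(** * A smooth step function *)

Section smooth.
Context {R : realType}.
Implicit Types (f g : R -> R) (p q : {poly R}).

Lemma norm_horner_le_expR p :
  exists2 C : R, 0 <= C & forall y : R, 0 <= y -> `|p.[y]| <= C * expR y.
Proof.
exists (\sum_(i < size p) `|p`_i| * i`!%:R).
  by apply: sumr_ge0 => i _; rewrite mulr_ge0.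
move=> y y0; rewrite horner_coef mulr_suml.
apply: le_trans (ler_norm_sum _ _ _) _; apply: ler_sum => i _.
rewrite normrM -mulrA ler_wpM2l// ger0_norm ?exprn_ge0//.
case: (nat_of_ord i) => [|n]; first by rewrite expr0 mul1r -expR0 ler_expR.
have := expR_ge1Dxn n y0.
have f0 : 0 < n.+1`!%:R :> R by rewrite ltr0n fact_gt0.
move=> h; rewrite mulrC -ler_pdivrMr//.
by apply: le_trans h; rewrite lerDr.
Qed.

(** The functions P(1/x) exp(-1/x), extended by 0 to x <= 0. Allowing the
    polynomial factor makes the family closed under differentiation. *)
Definition flat p (x : R) : R :=
  if 0 < x then p.[x^-1] * expR (- x^-1) else 0.

(** The gain of a factor |x| at the origin makes every [flat p] continuous
    there, and, applied to p * 'X, differentiable with derivative 0. *)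
Lemma norm_flat_le p : exists2 C : R, 0 <= C & forall x : R, `|flat p x| <= C * `|x|.
Proof.
have [C C0 pC] := norm_horner_le_expR (p * 'X); exists C => // x.
rewrite /flat; case: ifPn => [x0|_]; last by rewrite normr0 mulr_ge0.
have xi : 0 < x^-1 by rewrite invr_gt0.
have := pC _ (ltW xi); rewrite hornerMX normrM (gtr0_norm xi) => h.
rewrite normrM (gtr0_norm (expR_gt0 _)) expRN (gtr0_norm x0).
by rewrite ler_pdivrMr ?expR_gt0// mulrAC -ler_pdivrMr.
Qed.

Lemma is_derive_flat p (x : R) :
  is_derive x 1 (flat p) (flat ('X^2 * (p - p^`())) x).
Proof.
have [x0|x0|->] := ltgtP x 0.
- rewrite [flat _ x]/flat ltNge ltW//=.
  apply: (@near_eq_is_derive _ _ _ (cst 0)) => //.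
  by near=> z; rewrite /flat ltNge ltW//=; near: z; exact: lt_nbhsl.
- rewrite [flat _ x]/flat x0.
  apply: (@near_eq_is_derive _ _ _ ((horner p \o GRing.inv) *
      (expR \o (fun y => - y^-1)))) => //.
    by near=> z; rewrite /flat ifT//; near: z; exact: lt_nbhsr.
  have dV : is_derive x 1 (@GRing.inv R) (- x ^- 2).
    apply: is_derive_eq; first by apply: (@is_deriveV R id); rewrite gt_eqF.
    by rewrite scaler1.
  have dNV : is_derive x 1 (fun y : R => - y^-1) (x ^- 2).
    by apply: is_derive_eq; rewrite opprK.
  apply: is_derive_eq.
  rewrite /= /GRing.scale/= !hornerE /= exprVn; ring.
- rewrite [flat _ 0]/flat ltxx; apply/is_derive1_caratheodory.
  exists (flat (p * 'X)); split.
  + move=> z; rewrite /flat ltxx !subr0; case: ifPn => z0; last by rewrite mul0r.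
    by rewrite hornerMX -[RHS]mulrA [expR _ * z]mulrC mulrA divfK ?gt_eqF.
  + have [C C0 pC] := norm_flat_le (p * 'X).
    have fl0 : flat (p * 'X) 0 = 0 by rewrite /flat ltxx.
    rewrite /prop_for /continuous_at /= fl0; apply/cvgrPdist_le => e e0 /=.
    have C1 : 0 < C + 1 by rewrite ltr_wpDl.
    near=> z; rewrite sub0r normrN (le_trans (pC z))//.
    apply: (@le_trans _ _ ((C + 1) * `|z|)); first by rewrite ler_wpM2r// lerDl.
    rewrite mulrC -ler_pdivlMr//.
    near: z; exact: (@nbhs0_le _ R _ (divr_gt0 e0 C1)).
  + by rewrite /flat ltxx.
Unshelve. all: by end_near. Qed.

Lemma is_derive_affine (a b x : R) : is_derive x 1 (fun y : R => a * y + b) a.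
Proof.
have -> : (fun y : R => a * y + b) = a \*: (@id R) + cst b by [].
by apply: is_derive_eq; rewrite addr0 /GRing.scale/= mulr1.
Qed.

(** A class of functions that is closed under differentiation and contains the
    steps, ramps and plateaus built below: smoothness of its members is then a trivial
    induction on the order of the derivative, and needs no Leibniz or quotient
    rule for higher derivatives. *)
Inductive elementary : (R -> R) -> Prop :=
| el_flat p : elementary (flat p)
| el_affine f (a b : R) : elementary f -> elementary (fun x => f (a * x + b))
| el_scale f (a : R) : elementary f -> elementary (fun x => a * f x)
| el_add f g : elementary f -> elementary g -> elementary (fun x => f x + g x)
| el_mul f g : elementary f -> elementary g -> elementary (fun x => f x * g x)
| el_inv f : elementary f -> (forall x, f x != 0) ->
    elementary (fun x => (f x)^-1).

Lemma elementary_derive f : elementary f ->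
  exists2 f', elementary f' & forall x : R, is_derive x 1 f (f' x).
Proof.
elim=> {f}.
- move=> p; exists (flat ('X^2 * (p - p^`()))) => [|x]; first exact: el_flat.
  exact: is_derive_flat.
- move=> f a b _ [f' ef' df].
  exists (fun x => a * f' (a * x + b)) => [|x].
    exact/el_scale/el_affine.
  have := @is_derive1_comp R f (fun y => a * y + b) x _ _ (df _)
    (is_derive_affine a b x).
  by rewrite mulrC.
- move=> f a _ [f' ef' df]; exists (fun x => a * f' x) => [|x].
    exact: el_scale.
  exact: is_deriveZ.
- move=> f g _ [f' ef' df] _ [g' eg' dg].
  exists (fun x => f' x + g' x) => [|x]; first exact: el_add.
  exact: is_deriveD.
- move=> f g ef [f' ef' df] eg [g' eg' dg].
  exists (fun x => f x * g' x + g x * f' x) => [|x].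
    by apply: el_add; exact: el_mul.
  exact: is_deriveM.
- move=> f ef [f' ef' df] f0.
  exists (fun x => -1 * (((f x)^-1 * (f x)^-1) * f' x)) => [|x].
    by apply: el_scale; apply: el_mul => //; apply: el_mul; exact: el_inv.
  have /is_derive_eq := @is_deriveV R f x _ 1 (f0 x) (df x); apply.
  by rewrite /GRing.scale/= mulN1r mulNr expr2 invfM.
Qed.

Lemma elementary_derivable f (x : R) : elementary f -> derivable f x 1.
Proof. by move=> /elementary_derive[f' _ df]; exact: ex_derive. Qed.

Lemma elementary_derive1 f : elementary f -> elementary (derive1 f).
Proof.
move=> /elementary_derive[f' ef' df]; suff -> : derive1 f = f' by [].
by apply/funext => x; rewrite derive1E derive_val.
Qed.

Lemma elementary_smooth f (n : nat) (x : R) : elementary f ->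
  derivable (derive1n n f) x 1.
Proof.
move=> ef; apply: elementary_derivable.
elim: n => [|n]; first by rewrite derive1n0.
by rewrite derive1nS; exact: elementary_derive1.
Qed.

Lemma elementary_continuous f : elementary f -> continuous f.
Proof.
move=> ef x.
by apply/differentiable_continuous/derivable1_diffP/elementary_derivable.
Qed.

Lemma flat1_gt0 (x : R) : 0 < x -> 0 < flat 1 x.
Proof. by move=> x0; rewrite /flat x0 hornerC mul1r expR_gt0. Qed.

Lemma flat1_ge0 (x : R) : 0 <= flat 1 x.
Proof.
by rewrite /flat; case: ifP => // _; rewrite hornerC mul1r expR_ge0.
Qed.

(** The classical step f(x) / (f(x) + f(1 - x)). The argument 1 - x is spelled as
    an affine expression so that [elementary] applies syntactically; the same
    holds for ramps and plateaus. *)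
Definition smooth_step (x : R) : R :=
  flat 1 x * (flat 1 x + flat 1 (-1 * x + 1))^-1.

Lemma smooth_step_den_neq0 (x : R) : flat 1 x + flat 1 (-1 * x + 1) != 0.
Proof.
rewrite gt_eqF//; have [x0|x0] := ltP 0 x.
  by rewrite ltr_pwDl ?flat1_gt0 ?flat1_ge0.
by rewrite ltr_wpDl ?flat1_ge0// flat1_gt0//; lra.
Qed.

Lemma elementary_smooth_step : elementary smooth_step.
Proof.
apply: el_mul; first exact: el_flat.
apply: el_inv; last exact: smooth_step_den_neq0.
by apply: el_add; [exact: el_flat|apply: el_affine; exact: el_flat].
Qed.

Lemma smooth_step_le0 (x : R) : x <= 0 -> smooth_step x = 0.
Proof. by move=> x0; rewrite /smooth_step /flat ltNge x0 mul0r. Qed.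

Lemma smooth_step_ge1 (x : R) : 1 <= x -> smooth_step x = 1.
Proof.
move=> x1; have := smooth_step_den_neq0 x; rewrite /smooth_step.
have -> : flat 1 (-1 * x + 1) = 0.
  by rewrite /flat ltNge (_ : -1 * x + 1 <= 0)//; lra.
by rewrite addr0 => ?; rewrite mulfV.
Qed.

Lemma smooth_step_01 (x : R) : 0 <= smooth_step x <= 1.
Proof.
have := smooth_step_den_neq0 x; rewrite /smooth_step => h.
have p : 0 < flat 1 x + flat 1 (-1 * x + 1).
  by rewrite lt_def h/= addr_ge0// flat1_ge0.
apply/andP; split; first by rewrite divr_ge0 ?flat1_ge0 ?ltW.
by rewrite ler_pdivrMr// mul1r lerDl flat1_ge0.
Qed.

Lemma derive1_smooth_step_out (x : R) :
  ~~ (0 <= x <= 1) -> derive1 smooth_step x = 0.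
Proof.
rewrite derive1E negb_and -!ltNge => /orP[x0|x1].
- rewrite -(derive1_cst (0 : R) x) derive1E; apply: near_eq_derive.
  near=> z; rewrite smooth_step_le0//; apply: ltW; near: z.
  exact: lt_nbhsl.
- rewrite -(derive1_cst (1 : R) x) derive1E; apply: near_eq_derive.
  near=> z; rewrite smooth_step_ge1//; apply: ltW; near: z.
  exact: lt_nbhsr.
Unshelve. all: by end_near. Qed.

Lemma derive1_smooth_step_bounded :
  exists2 M : R, 0 <= M & forall x : R, `|derive1 smooth_step x| <= M.
Proof.
have cn : {within `[(0:R), 1], continuous (fun x => `|derive1 smooth_step x|)}.
  apply: continuous_subspaceT => x; apply: continuous_comp.
    exact/elementary_continuous/elementary_derive1/elementary_smooth_step.
  exact: norm_continuous.
have [c _ cM] := EVT_max ler01 cn.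
exists `|derive1 smooth_step c|; first exact: normr_ge0.
move=> x.
have [/= x01|x01] := boolP (x \in `[0, 1]%R); first exact: cM.
by rewrite derive1_smooth_step_out ?normr0.
Qed.

End smooth.

(** * A continuous function is an antiderivative of its weak derivative *)

Section weak_derivative.
Context {R : realType}.
Local Notation mu := (@lebesgue_measure R).
Implicit Types (v w g : R -> R).

Definition ramp (c e x : R) : R := smooth_step (e^-1 * x + - (e^-1 * c)).

Lemma elementary_ramp (c e : R) : elementary (ramp c e).
Proof. exact/el_affine/elementary_smooth_step. Qed.

Lemma ramp_le (c e x : R) : 0 < e -> x <= c -> ramp c e x = 0.
Proof.
move=> e0 xc; rewrite /ramp smooth_step_le0// -mulrBr.
by rewrite mulr_ge0_le0 ?subr_le0// invr_ge0 ltW.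
Qed.

Lemma ramp_ge (c e x : R) : 0 < e -> c + e <= x -> ramp c e x = 1.
Proof.
move=> e0 xc; rewrite /ramp smooth_step_ge1// -mulrBr mulrC ler_pdivlMr//.
by rewrite mul1r lerBrDl.
Qed.

Lemma derive1_ramp (c e x : R) :
  derive1 (ramp c e) x = e^-1 * derive1 smooth_step (e^-1 * x + - (e^-1 * c)).
Proof.
have ds : is_derive (e^-1 * x + - (e^-1 * c)) 1 (@smooth_step R)
    (derive1 smooth_step (e^-1 * x + - (e^-1 * c))).
  rewrite derive1E; apply: derivableP.
  exact/elementary_derivable/elementary_smooth_step.
have [_ D] := @is_derive1_comp R smooth_step
  (fun y => e^-1 * y + - (e^-1 * c)) x _ _ ds (is_derive_affine _ _ x).
by rewrite [RHS]mulrC -D derive1E.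
Qed.

Lemma continuous_derive1_ramp (c e : R) : continuous (derive1 (ramp c e)).
Proof.
exact/elementary_continuous/elementary_derive1/elementary_ramp.
Qed.

(** The derivative of [ramp c e] is an approximate Dirac mass at c: it lives on
    [c, c + e], has total mass 1 and is at most M / e. *)
Lemma integral_ramp_approx w (M c e d : R) :
  {within `[0, 1], continuous w} ->
  (forall x : R, `|derive1 smooth_step x| <= M) ->
  0 < c -> 0 < e -> c + e < 1 ->
  (forall x, c <= x <= c + e -> `|w x - w c| <= d) ->
  `|\int[mu]_(x in `[0, 1]) (w x * derive1 (ramp c e) x) - w c| <= d * M.
Proof.
move=> cw s'M c0 e0 ce1 wd.
set r := derive1 (ramp c e).
have rE x : r x = e^-1 * derive1 smooth_step (e^-1 * x + - (e^-1 * c)).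
  exact: derive1_ramp.
have r0 x : ~ `[c, c + e]%classic x -> r x = 0.
  rewrite /= in_itv/= => /negP xce; rewrite rE derive1_smooth_step_out ?mulr0//.
  apply: contra xce; rewrite -mulrBr mulrC.
  rewrite ler_pdivrMr// ler_pdivlMr// mul0r mul1r subr_ge0.
  by rewrite lerBlDl.
have cr : {within `[0, 1], continuous r}.
  by apply: continuous_subspaceT; exact: continuous_derive1_ramp.
have cpt01 : compact (`[0, 1]%classic : set R) by exact: segment_compact.
have ir : mu.-integrable `[0, 1] (EFin \o r).
  exact: continuous_compact_integrable.
have iwr : mu.-integrable `[0, 1] (EFin \o (fun x => w x * r x)).
  apply: continuous_compact_integrable => // x.
  by apply: cvgM; [exact: cw|exact: cr].
have iwcr : mu.-integrable `[0, 1] (EFin \o (fun x => w c * r x)).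
  apply: continuous_compact_integrable => // x.
  by apply: cvgMr; exact: cr.
have I1 : \int[mu]_(x in `[0, 1]) r x = 1.
  have drx x : derivable (ramp c e) x 1.
    exact/elementary_derivable/elementary_ramp.
  have cramp : continuous (ramp c e).
    exact/elementary_continuous/elementary_ramp.
  have FTC : derivable_oo_LRcontinuous (ramp c e) 0 1.
    split; first by move=> x _; exact: drx.
    - by apply: cvg_at_right_filter; exact: cramp.
    - by apply: cvg_at_left_filter; exact: cramp.
  rewrite /Rintegral (continuous_FTC2 ltr01 cr FTC (fun=> fun=> erefl)).
  by rewrite (ramp_le e0 (ltW c0)) (ramp_ge e0 (ltW ce1)) /= subr0.
have -> : \int[mu]_(x in `[0, 1]) (w x * r x) - w c =
  \int[mu]_(x in `[c, c + e]) ((w x - w c) * r x).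
  transitivity (\int[mu]_(x in `[0, 1]) (w x * r x) -
                \int[mu]_(x in `[0, 1]) (w c * r x)).
    by rewrite RintegralZl// I1 mulr1.
  rewrite -RintegralB//.
  rewrite (_ : `[c, c + e]%classic = `[0, 1] `&` `[c, c + e]); last first.
    rewrite setIC setIidl//; apply: subset_itv; rewrite bnd_simp//; exact: ltW.
  rewrite Rintegral_mkcondr; apply: eq_Rintegral => x _ /=.
  rewrite patchE; case: ifPn => [_|]; first by rewrite mulrBl.
  by rewrite notin_setE => /r0 ->; rewrite !mulr0 subr0.
have sub : `[c, c + e]%classic `<=` (`[0, 1]%classic : set R).
  by apply: subset_itv; rewrite bnd_simp; exact: ltW.
have id : mu.-integrable `[c, c + e] (EFin \o (fun x => (w x - w c) * r x)).
  suff H : mu.-integrable `[0, 1] (EFin \o (fun x => (w x - w c) * r x)).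
    exact: (@integrableS _ _ _ mu _ _ _ _ _ sub H).
  apply: continuous_compact_integrable => // x.
  apply: cvgM; last exact: cr.
  by apply: cvgB; [exact: cw|exact: cvg_cst].
apply: le_trans (le_normr_Rintegral _ id) _ => //.
apply: (@le_trans _ _ (\int[mu]_(x in `[c, c + e]) (d * (e^-1 * M)))).
  apply: le_Rintegral => //.
  - apply/integrable_abse: id.
  - apply: continuous_compact_integrable; first exact: segment_compact.
    by apply: continuous_subspaceT => x; exact: cvg_cst.
  - move=> x /=; rewrite in_itv/= => xce; rewrite normrM ler_pM//.
      exact: wd.
    by rewrite rE normrM gtr0_norm ?invr_gt0// ler_wpM2l// invr_ge0 ltW.
rewrite Rintegral_cst//= lebesgue_measure_itv/= lte_fin ltrDl e0/=.
rewrite (_ : d * (e^-1 * M) * (c + e - c) = d * M)//.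
by field; rewrite gt_eqF.
Qed.

Definition plateau (a b e x : R) : R := ramp a e x + -1 * ramp b e x.

Lemma elementary_plateau (a b e : R) : elementary (plateau a b e).
Proof. by apply: el_add; [|apply: el_scale]; exact: elementary_ramp. Qed.

Lemma plateau_out (a b e x : R) : 0 < e -> a + e <= b ->
  ~ `[a, b + e]%classic x -> plateau a b e x = 0.
Proof.
move=> e0 ab /= /negP; rewrite in_itv/= negb_and -!ltNge /plateau => /orP[xa|bx].
  by rewrite !ramp_le//; [rewrite mulr0 addr0|lra|lra].
by rewrite !ramp_ge//; [rewrite mulr1 subrr|lra|lra].
Qed.

Lemma plateau_test (a b e : R) : 0 < e -> 0 < a -> a + e <= b -> b + e < 1 ->
  test_function (plateau a b e).
Proof.
move=> e0 a0 ab b1; split; first by move=> n x; exact/elementary_smooth/elementary_plateau.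
exists `[a, b + e]%classic; split; first exact: segment_compact.
  by apply: subset_itv; rewrite bnd_simp.
by move=> x; exact: plateau_out.
Qed.

Lemma plateau_le1 (a b e x : R) : `|plateau a b e x| <= 1.
Proof.
rewrite /plateau /ramp.
have /andP[p1 p2] := smooth_step_01 (e^-1 * x + - (e^-1 * a)).
have /andP[q1 q2] := smooth_step_01 (e^-1 * x + - (e^-1 * b)).
by rewrite ler_norml; lra.
Qed.

Lemma derive1_plateau (a b e x : R) :
  derive1 (plateau a b e) x = derive1 (ramp a e) x - derive1 (ramp b e) x.
Proof.
have da : derivable (ramp a e) x 1.
  exact/elementary_derivable/elementary_ramp.
have db : derivable (ramp b e) x 1.
  exact/elementary_derivable/elementary_ramp.
rewrite !derive1E.
have -> : plateau a b e = ramp a e + (-1) \*: ramp b e by [].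
have dz : derivable ((-1) \*: ramp b e) x 1 by exact: derivableZ.
rewrite (deriveD da dz) deriveZ; last exact: db.
by rewrite scaleN1r.
Qed.

Lemma plateau_cvg (a b x : R) (e : R ^nat) : a < b ->
  (forall n, 0 < e n) -> e n @[n --> \oo] --> (0 : R) ->
  plateau a b (e n) x @[n --> \oo] --> (\1_(`]a, b]%classic) x : R).
Proof.
move=> ab e0 e_to0; apply: cvg_near_cst.
have near_lt (d : R) : 0 < d -> \forall n \near \oo, e n < d.
  by move=> d0; apply: (cvgr_lt 0).
rewrite indicE; case: (leP x a) => xa.
  rewrite memNset/=; last by rewrite in_itv/= ltNge xa.
  apply: nearW => n; rewrite /plateau !ramp_le ?mulr0 ?addr0//.
  by rewrite (le_trans xa)// ltW.
case: (leP x b) => xb.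
  rewrite mem_set/=; last by rewrite in_itv/= xa.
  have xa0 : 0 < x - a by rewrite subr_gt0.
  near=> n; rewrite /plateau (ramp_le (e0 n) xb) ramp_ge ?mulr0 ?addr0//.
  rewrite -lerBrDl ltW//; near: n; exact: near_lt.
rewrite memNset/=; last by rewrite in_itv/= leNgt xb andbF.
have xb0 : 0 < x - b by rewrite subr_gt0.
near=> n.
have en : e n < x - b by near: n; exact: near_lt.
by rewrite /plateau !ramp_ge ?mulr1 ?subrr//; lra.
Unshelve. all: by end_near. Qed.

Lemma cvg_integral_ramp w (c : R) (e : R ^nat) :
  {within `[0, 1], continuous w} -> 0 < c ->
  (forall n, 0 < e n) -> (forall n, c + e n < 1) ->
  e n @[n --> \oo] --> (0 : R) ->
  \int[mu]_(x in `[0, 1]) (w x * derive1 (ramp c (e n)) x) @[n --> \oo] --> w c.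
Proof.
move=> cw c0 e0 ce1 e_to0.
have [M M0 s'M] := @derive1_smooth_step_bounded R.
apply/cvgrPdist_le => eps eps0.
have M1 : 0 < M + 1 by rewrite ltr_wpDl.
have c1 : c < 1 by rewrite (le_lt_trans _ (ce1 0%N))// lerDl ltW.
have ccw : w x @[x --> c] --> w c.
  have [+ _ _] := (continuous_within_itvP w ltr01).1 cw.
  by apply; rewrite in_itv/= c0.
have /cvgrPdist_le /(_ _ (divr_gt0 eps0 M1)) /nbhs_ballP[d /= d0 dw] := ccw.
near=> n.
have en : e n < d by near: n; exact: (cvgr_lt (0:R)).
rewrite distrC.
apply: le_trans (integral_ramp_approx cw s'M c0 (e0 n) (ce1 n) _) _.
  move=> x /andP[cx xc]; rewrite distrC; apply: dw.
  by rewrite /ball/= distrC ger0_norm ?subr_ge0//; lra.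
by rewrite -mulrA ger_pMr// ler_pdivrMl// mulr1 lerDl.
Unshelve. all: by end_near. Qed.

(** The weak derivative tested against a plateau. On the left, v is replaced by
    its continuous representative, whose point values the ramps pick out. *)
Lemma is_weak_derivative_plateau v w g (a b e : R) : is_weak_derivative v g ->
  continuous_representative v w ->
  0 < e -> 0 < a -> a + e <= b -> b + e < 1 ->
  \int[mu]_(x in `[0, 1]) (w x * derive1 (ramp a e) x) -
  \int[mu]_(x in `[0, 1]) (w x * derive1 (ramp b e) x) =
  - \int[mu]_(x in `]0, 1[) (g x * plateau a b e x).
Proof.
move=> [[mv _ _] _ vg] [cw vw] e0 a0 ab b1.
rewrite -(vg _ (plateau_test e0 a0 ab b1)).
have iwr c : mu.-integrable `[0, 1] (EFin \o (fun x => w x * derive1 (ramp c e) x)).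
  apply: continuous_compact_integrable; first exact: segment_compact.
  move=> x; apply: cvgM; first exact: cw.
  by apply: continuous_subspaceT; exact: continuous_derive1_ramp.
rewrite -RintegralB//.
rewrite -[LHS]/(fine _) -[RHS]/(fine _); congr fine.
pose wd (x : R) : R := w x * derive1 (ramp a e) x - w x * derive1 (ramp b e) x.
have mwb : measurable_fun (`]0, 1[%classic : set R) wd.
  have m c : measurable_fun (`]0, 1[%classic : set R) (fun x => w x * derive1 (ramp c e) x).
    have /measurable_int/measurable_EFinP := iwr c.
    apply: measurable_funS => //.
    by apply: subset_itv; rewrite bnd_simp.
  by apply: measurable_funB; exact: m.
rewrite -[LHS]/(\int[mu]_(x in `[0%R, 1%R]) (wd x)%:E)%E.
rewrite integral_itv_bndoo//; last exact/measurable_EFinP.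
apply: ae_eq_integral => //.
- by apply/measurable_EFinP.
- apply/measurable_EFinP; apply: measurable_funM => //.
  rewrite (_ : derive1 _ = fun x => derive1 (ramp a e) x - derive1 (ramp b e) x).
    2: by apply/funext => x; exact: derive1_plateau.
  apply: measurable_funTS; apply: measurable_funB;
    by apply: continuous_measurable_fun; exact: continuous_derive1_ramp.
- near=> x => x01; have vwx : `[0, 1]%classic x -> v x = w x by near: x; exact: vw.
  rewrite vwx; first by rewrite derive1_plateau mulrBr.
  by apply: subset_itv x01; rewrite bnd_simp.
Unshelve. all: by end_near. Qed.

(** The integrability clause guards against the default value 0 that the
    integral of a non-integrable function takes. *)
Definition antiderivative w g : Prop :=
  forall a b : R, 0 < a -> a < b -> b < 1 ->
    mu.-integrable `]a, b] (EFin \o g) /\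
    w b - w a = \int[mu]_(x in `]a, b]) g x.

(** Letting the ramps of the plateaus on ]a,b] shrink, one side of the identity
    of [is_weak_derivative_plateau] tends to w(a) - w(b), the other one to
    minus the integral of g by dominated convergence. *)
Lemma weak_derivative_antiderivative v w g : is_weak_derivative v g ->
  continuous_representative v w -> antiderivative w g.
Proof.
move=> vg vw a b a0 ab b1.
have [_ [mg _ lg] _] := vg.
have cw := vw.1.
(* h keeps the ramps disjoint and inside ]0, 1[. *)
pose h := Num.min (b - a) ((1 - b) / 2).
have h0 : 0 < h by rewrite lt_min subr_gt0 ab divr_gt0// subr_gt0.
have ha : h <= b - a by rewrite ge_min lexx.
have hb : h <= (1 - b) / 2 by rewrite ge_min lexx orbT.
pose e (n : nat) : R := h * n.+1%:R^-1.
have e0 n : 0 < e n by rewrite mulr_gt0.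
have eh n : e n <= h by rewrite ger_pMr// invf_le1// ler1n.
have e_to0 : e n @[n --> \oo] --> (0 : R).
  by rewrite -(mulr0 h); apply: cvgMr; exact: cvg_harmonic.
pose B := b + h.
have aB : `[a, B]%classic `<=` (`]0, 1[%classic : set R).
  by apply: subset_itv; rewrite bnd_simp// /B; lra.
have ig : mu.-integrable `[a, B] (EFin \o g).
  apply/integrableP; split; last by have := lg _ aB (@segment_compact _ a B).
  by apply/measurable_EFinP; exact: measurable_funS mg.
have abB : `]a, b]%classic `<=` (`[a, B]%classic : set R).
  by apply: subset_itv; rewrite bnd_simp// /B lerDl ltW.
split; first exact: (@integrableS _ _ _ mu _ _ _ _ _ abB ig).
have L : (- \int[mu]_(x in `]0, 1[) (g x * plateau a b (e n) x))
    @[n --> \oo] --> w a - w b.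
  rewrite (_ : (fun n => _) = (fun n =>
    \int[mu]_(x in `[0, 1]) (w x * derive1 (ramp a (e n)) x) -
    \int[mu]_(x in `[0, 1]) (w x * derive1 (ramp b (e n)) x))); last first.
    apply/funext => n; have ehn := eh n.
    by rewrite (is_weak_derivative_plateau vg vw)//; lra.
  apply: cvgB; apply: cvg_integral_ramp => //; [|lra|] => n; have ehn := eh n; lra.
have IE n : \int[mu]_(x in `]0, 1[) (g x * plateau a b (e n) x) =
    fine (\int[mu]_(x in `[a, B]) (g x * plateau a b (e n) x)%:E)%E.
  rewrite -[RHS]/(\int[mu]_(x in `[a, B]) (g x * plateau a b (e n) x))%R.
  rewrite -(setIidr aB) Rintegral_mkcondr; apply: eq_Rintegral => x _ /=.
  rewrite patchE; case: ifPn => //; rewrite notin_setE => xaB.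
  rewrite plateau_out ?mulr0//; first by have ehn := eh n; lra.
  apply: contra_not xaB; apply: subset_itv; rewrite bnd_simp// /B.
  by rewrite lerD2l.
have [i1 _ D] : [/\ mu.-integrable `[a, B] (fun x => (g x * \1_(`]a, b]%classic) x)%:E),
  (\int[mu]_(x in `[a, B]) `|(g x * plateau a b (e n) x)%:E - (g x * \1_(`]a, b]%classic) x)%:E|
      @[n --> \oo] --> 0)%E &
  (\int[mu]_(x in `[a, B]) (g x * plateau a b (e n) x)%:E @[n --> \oo] -->
   \int[mu]_(x in `[a, B]) (g x * \1_(`]a, b]%classic) x)%:E)%E].
  have mg' : measurable_fun (`[a, B]%classic : set R) g by exact: measurable_funS mg.
  apply: (@dominated_convergence _ _ _ mu _ _ _ _ (fun x => `|(g x)%:E|%E)) => //.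
  - move=> n; apply/measurable_EFinP; apply: measurable_funM => //.
    apply: measurable_funTS; apply: continuous_measurable_fun.
    exact/elementary_continuous/elementary_plateau.
  - by apply/measurable_EFinP; apply: measurable_funM.
  - apply: aeW => x _; apply: cvg_EFin; first exact: nearW.
    by apply: cvgMr; exact: plateau_cvg.
  - exact: integrable_abse.
  - apply: aeW => x n _; rewrite lee_fin normrM ler_piMr//.
    exact: plateau_le1.
rewrite -(fineK (integrable_fin_num _ i1))// in D.
have J : \int[mu]_(x in `]0, 1[) (g x * plateau a b (e n) x) @[n --> \oo] -->
    \int[mu]_(x in `]a, b]) g x.
  have -> : \int[mu]_(x in `]a, b]) g x =
      fine (\int[mu]_(x in `[a, B]) (g x * \1_(`]a, b]%classic) x)%:E)%E.
    rewrite -[RHS]/(\int[mu]_(x in `[a, B]) (g x * \1_(`]a, b]%classic) x))%R.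
    rewrite -(setIidr abB) Rintegral_mkcondr; apply: eq_Rintegral => x _ /=.
    by rewrite (setIidr abB) patchE indicE; case: ifPn; rewrite ?mulr1 ?mulr0.
  under eq_cvg do rewrite IE.
  exact: fine_cvg D.
have E : w a - w b = - \int[mu]_(x in `]a, b]) g x.
  exact: cvg_unique _ L (cvgN J).
by rewrite -[LHS]opprB E opprK.
Qed.
End weak_derivative.

(** * Mean value estimates and a gluing principle *)

Section local_global.
Context {R : realType}.

(** A transitive relation that holds on all short intervals holds on [a, b]: the
    supremum of the points that can be reached from a can only be b. *)
Lemma local_to_global (P : R -> R -> Prop) (a b : R) : a <= b ->
  (forall x y z, a <= x -> x <= y -> y <= z -> z <= b ->
    P x y -> P y z -> P x z) ->
  (forall x, a <= x <= b -> exists2 d, 0 < d & forall y z,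
    a <= y -> y <= z -> z <= b -> `|y - x| < d -> `|z - x| < d -> P y z) ->
  P a b.
Proof.
move=> ab tr loc; pose S := [set x | a <= x <= b /\ P a x].
have Sa : S a.
  have [|d d0 Pd] := loc a; first by rewrite lexx.
  by split; [rewrite lexx|apply: Pd => //; rewrite subrr normr0].
have hS : has_sup S.
  by split; [exists a|exists b => x [/andP[]]].
pose s := sup S.
have as_ : a <= s by exact: sup_upper_bound.
have sb : s <= b by apply: ge_sup; [exists a|move=> x [/andP[]]].
have [|d d0 Pd] := loc s; first by rewrite as_.
have [y [/andP[ay yb] Pay] sy] := sup_adherent d0 hS.
have ys : y <= s by apply: sup_upper_bound => //; split => //; rewrite ay.
pose z := Num.min (s + d / 2) b.
have zb : z <= b by rewrite ge_min lexx orbT.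
have zs : z <= s + d / 2 by rewrite ge_min lexx.
have sz : s <= z by rewrite le_min sb andbT lerDl divr_ge0// ltW.
have Paz : P a z.
  apply: (tr a y z) => //; first exact: le_trans sz.
  apply: Pd => //; first exact: le_trans sz.
    by rewrite distrC ger0_norm ?subr_ge0//; rewrite -/s in sy; lra.
  by rewrite ger0_norm ?subr_ge0//; lra.
have : z <= s.
  by apply: sup_upper_bound => //; split => //; rewrite zb andbT (le_trans as_).
rewrite /z ge_min => /orP[|bs]; first by lra.
by have -> : b = z by apply/le_anti; rewrite zb andbT (le_trans bs).
Qed.

Lemma cos_mean_value (x y : R) : exists2 c : R,
  Num.min x y <= c <= Num.max x y & cos y - cos x = - sin c * (y - x).
Proof.
wlog xy : x y / x <= y.
  move=> H; have /orP[xy|yx] := le_total x y; first exact: H.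
  have [c cxy E] := H y x yx; exists c.
    by rewrite minC maxC.
  by rewrite -[LHS]opprB E; ring.
have cc : {within `[x, y], continuous (@cos R)}.
  by apply: continuous_subspaceT => z; exact: continuous_cos.
have [c cxy E] := MVT_segment xy (fun z _ => is_derive_cos z) cc.
exists c => //; rewrite min_l// max_r//.
Qed.

Lemma sin_lipschitz (x y : R) : `|sin y - sin x| <= `|y - x|.
Proof.
wlog xy : x y / x <= y.
  move=> H; have [xy|yx] := leP x y; first exact: H.
  by rewrite distrC [leRHS]distrC; apply: H; exact: ltW.
have cs : {within `[x, y], continuous (@sin R)}.
  by apply: continuous_subspaceT => z; exact: continuous_sin.
have [c cxy ->] := MVT_segment xy (fun z _ => is_derive_sin z) cs.
by rewrite normrM ler_piMl// cos_max.
Qed.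

End local_global.

(** * Variation of the cosine is bounded by the energy *)

Section energy.
Context {R : realType}.
Local Notation mu := (@lebesgue_measure R).
Implicit Types (u w g : R -> R).

(** The weight eps absorbs the oscillation of sin w on an interval so short that
    w varies by at most eps there; the weighted inequality is exact on such
    intervals and therefore adds up without loss. *)
Lemma cos_increment_le_eps w g (a b eps : R) :
  {within `[0, 1], continuous w} ->
  measurable_fun (`]0, 1[%classic : set R) g ->
  antiderivative w g ->
  0 < a -> a <= b -> b < 1 -> 0 < eps ->
  (`|cos (w b) - cos (w a)|%:E <=
   \int[mu]_(x in `]a, b]) ((`|sin (w x)| + eps) * `|g x|)%:E)%E.
Proof.
move=> cw mg wg a0 ab b1 eps0.
have mw : measurable_fun (`]0, 1[%classic : set R) w.
  have : measurable_fun (`[0, 1]%classic : set R) w.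
    exact: subspace_continuous_measurable_fun.
  by apply: measurable_funS => //; apply: subset_itv; rewrite bnd_simp.
pose h (x : R) : R := (`|sin (w x)| + eps) * `|g x|.
have h0 x : 0 <= h x by rewrite mulr_ge0// addr_ge0// ltW.
have mh : measurable_fun (`]0, 1[%classic : set R) h.
  apply: measurable_funM; last exact: measurableT_comp.
  apply: measurable_funD => //; apply: measurableT_comp => //.
  apply: measurableT_comp => //; apply: continuous_measurable_fun.
  exact: continuous_sin.
have sub (y z : R) : a <= y -> z <= b ->
    `]y, z]%classic `<=` (`]0, 1[%classic : set R).
  by move=> ay zb; apply: subset_itv; rewrite bnd_simp; [rewrite (le_trans (ltW a0))|rewrite (le_lt_trans zb)].
apply: (@local_to_global _ (fun y z => `|cos (w z) - cos (w y)|%:E <=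
   \int[mu]_(x in `]y, z]) (h x)%:E)%E) => //.
- move=> x y z ax xy yz zb Pxy Pyz.
  rewrite (@itv_bndbnd_setU _ _ _ (BRight y)) ?bnd_simp//.
  rewrite ge0_integral_setU//=; first last.
  + by apply/disj_setPLR => t /=; rewrite !in_itv/= => /andP[_ ty] /negP; rewrite ltNge ty.
  + by move=> t _; rewrite lee_fin.
  + rewrite -itv_bndbnd_setU ?bnd_simp//; apply/measurable_EFinP.
    by apply: measurable_funS mh => //; exact: sub.
  apply: le_trans (leeD Pxy Pyz); rewrite -EFinD lee_fin.
  by rewrite [leRHS]addrC ler_distD.
- move=> x /andP[ax xb].
  have x0 : 0 < x by exact: lt_le_trans ax.
  have x1 : x < 1 by exact: le_lt_trans b1.
  have ccw : w x @[x --> x] --> w x.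
    have [+ _ _] := (continuous_within_itvP w ltr01).1 cw.
    by apply; rewrite in_itv/= x0.
  have e2 : 0 < eps / 2 by rewrite divr_gt0.
  have /cvgrPdist_le /(_ _ e2) /nbhs_ballP[d /= d0 dw] := ccw.
  exists d => // y z ay yz zb yx zx.
  have wd t : y <= t <= z -> `|w t - w x| <= eps / 2.
    move=> /andP[yt tz]; rewrite distrC; apply: dw.
    rewrite /ball/= distrC; move: yx zx; rewrite !ltr_norml; lra.
  have [->|yz'] := eqVneq y z.
    by rewrite subrr normr0 integral_ge0// => t _; rewrite lee_fin.
  have {yz'} ltyz : y < z by rewrite lt_neqAle yz'.
  have y0 : 0 < y by exact: lt_le_trans ay.
  have z1 : z < 1 by exact: le_lt_trans b1.
  have [ig wE] := wg _ _ y0 ltyz z1.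
  have [c cb ->] := cos_mean_value (w y) (w z).
  have cx : `|c - w x| <= eps / 2.
    have wy : `|w y - w x| <= eps / 2 by apply: wd; rewrite lexx.
    have wz : `|w z - w x| <= eps / 2 by apply: wd; rewrite lexx yz.
    move: cb wy wz; rewrite ge_min le_max => /andP[/orP[] ? /orP[] ?];
      rewrite !ler_norml; lra.
  have mg' : measurable_fun (`]y, z]%classic : set R) g.
    by apply: measurable_funS mg => //; exact: sub.
  rewrite normrM normrN EFinM wE EFin_normr_Rintegral//.
  apply: (@le_trans _ _ (`|sin c|%:E * \int[mu]_(t in `]y, z]) `|(g t)%:E|)%E).
    apply: lee_wpmul2l => //; apply: le_abse_integral => //.
    exact/measurable_EFinP.
  have mag : measurable_fun (`]y, z]%classic : set R) (fun t => `|g t|).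
    exact: measurableT_comp.
  rewrite -ge0_integralZl_EFin//; last exact/measurable_EFinP.
  apply: ge0_le_integral => //.
  + have : measurable_fun (`]y, z]%classic : set R) (fun t => `|sin c| * `|g t|).
      exact: measurable_funM.
    by move/measurable_EFinP.
  + by apply/measurable_EFinP; apply: measurable_funS mh => //; exact: sub.
  move=> t /=; rewrite in_itv/= => /andP[yt tz].
  rewrite -EFinM lee_fin ler_wpM2r//.
  have := sin_lipschitz (w t) c; have := wd t; rewrite (ltW yt) tz => /(_ isT).
  have := ler_normD (sin c - sin (w t)) (sin (w t)); rewrite subrK.
  have := ler_normD (c - w x) (w x - w t); rewrite addrA subrK [`|w x - w t|]distrC.
  lra.
Qed.

Definition energy_density u g (r : R) : R :=
  2^-1 * ((g r ^+ 2 + sin (u r) ^+ 2 / r ^+ 2) * r).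

Lemma energy_density_ge0 u g (r : R) : 0 <= r -> 0 <= energy_density u g r.
Proof.
move=> r0; rewrite mulr_ge0 ?invr_ge0// mulr_ge0// addr_ge0 ?sqr_ge0//.
by rewrite divr_ge0 ?sqr_ge0.
Qed.

(** Bogomolny's inequality: the difference of the two sides is the square
    (|g| r - |sin u|)^2 / (2 r). *)
Lemma sin_deriv_le_density u g (r : R) : 0 < r ->
  `|sin (u r)| * `|g r| <= energy_density u g r.
Proof.
move=> r0; rewrite /energy_density -(real_normK (num_real (g r))).
rewrite -(real_normK (num_real (sin (u r)))).
set s := `|sin _|; set t := `|g r|.
rewrite -subr_ge0 (_ : _ - _ = 2^-1 * (t * r - s) ^+ 2 / r); last first.
  by field; rewrite gt_eqF.
by rewrite divr_ge0 ?(ltW r0)// mulr_ge0 ?sqr_ge0 ?invr_ge0.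
Qed.

Lemma measurable_energy_density u g :
  measurable_fun (`]0, 1[%classic : set R) u ->
  measurable_fun (`]0, 1[%classic : set R) g ->
  measurable_fun (`]0, 1[%classic : set R) (energy_density u g).
Proof.
move=> mu_ mg; apply: measurable_funM => //; apply: measurable_funM => //.
apply: measurable_funD; first exact: measurable_funX.
apply: measurable_funM.
  apply: measurable_funX; apply: measurableT_comp => //.
  by apply: continuous_measurable_fun; exact: continuous_sin.
apply: open_continuous_measurable_fun; first exact: interval_open.
move=> x; rewrite inE/= in_itv/= => /andP[x0 _].
apply: cvgV; first by rewrite expf_neq0// gt_eqF.
exact: exprn_continuous.
Qed.

Lemma cos_increment_le u w g (a b : R) :
  {within `[0, 1], continuous w} ->
  {ae mu, forall r, `[0, 1]%classic r -> u r = w r} ->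
  measurable_fun (`]0, 1[%classic : set R) u ->
  measurable_fun (`]0, 1[%classic : set R) g ->
  antiderivative w g ->
  0 < a -> a < b -> b < 1 ->
  (`|cos (w b) - cos (w a)|%:E <=
   \int[mu]_(x in `]a, b]) (energy_density u g x)%:E)%E.
Proof.
move=> cw uw mu_ mg wg a0 ab b1.
have sub : `]a, b]%classic `<=` (`]0, 1[%classic : set R).
  by apply: subset_itv; rewrite bnd_simp// ltW.
have mD : measurable_fun (`]a, b]%classic : set R) (energy_density u g).
  by apply: measurable_funS (measurable_energy_density mu_ mg).
have mg' : measurable_fun (`]a, b]%classic : set R) g.
  by apply: measurable_funS mg.
have mag : measurable_fun (`]a, b]%classic : set R) (fun t => `|g t|).
  exact: measurableT_comp.
have mw : measurable_fun (`]a, b]%classic : set R) w.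
  have : measurable_fun (`[0, 1]%classic : set R) w.
    exact: subspace_continuous_measurable_fun.
  by apply: measurable_funS => //; apply: subset_itv; rewrite bnd_simp// ltW.
have pos x : `]a, b]%classic x -> 0 < x.
  by rewrite /= in_itv/= => /andP[/(lt_trans a0)].
have [ig _] := wg _ _ a0 ab b1.
pose K := (\int[mu]_(x in `]a, b]) `|g x|%:E)%E.
have Kfin : K \is a fin_num.
  exact: integrable_fin_num (integrable_norm ig).
have K0 : 0 <= fine K by rewrite fine_ge0// integral_ge0.
apply/lee_addgt0Pr => eta eta0.
pose eps := eta / (fine K + 1).
have K1 : 0 < fine K + 1 by rewrite ltr_wpDl.
have eps0 : 0 < eps by rewrite divr_gt0.
apply: le_trans (cos_increment_le_eps cw mg wg a0 (ltW ab) b1 eps0) _.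
apply: (@le_trans _ _ (\int[mu]_(x in `]a, b])
    ((energy_density u g x)%:E + eps%:E * `|g x|%:E))%E).
  apply: ae_ge0_le_integral => //.
  - by move=> x _; rewrite lee_fin mulr_ge0// addr_ge0// ltW.
  - apply/measurable_EFinP; apply: measurable_funM => //.
    apply: measurable_funD => //; apply: measurableT_comp => //.
    apply: measurableT_comp => //; apply: continuous_measurable_fun.
    exact: continuous_sin.
  - move=> x xab; rewrite -EFinM -EFinD lee_fin addr_ge0//.
      by rewrite energy_density_ge0// ltW// pos.
    by rewrite mulr_ge0// ltW.
  - have : measurable_fun (`]a, b]%classic : set R)
        (fun x => energy_density u g x + eps * `|g x|).
      by apply: measurable_funD => //; exact: measurable_funM.
    by move/measurable_EFinP.
  near=> x => xab.
  have uwx : `[0, 1]%classic x -> u x = w x by near: x; exact: uw.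
  rewrite -EFinM -EFinD lee_fin mulrDl lerD2r -uwx.
    exact/sin_deriv_le_density/pos.
  by apply: subset_itv (sub _ xab); rewrite bnd_simp.
rewrite ge0_integralD//; last 4 first.
- by move=> x xab; rewrite lee_fin energy_density_ge0// ltW// pos.
- exact/measurable_EFinP.
- by move=> x _; rewrite -EFinM lee_fin mulr_ge0// ltW.
- have : measurable_fun (`]a, b]%classic : set R) (fun x => eps * `|g x|).
    exact: measurable_funM.
  by move/measurable_EFinP.
rewrite ge0_integralZl_EFin//; [|exact/measurable_EFinP|exact: ltW].
rewrite leeD2l// -/K -(fineK Kfin) -EFinM lee_fin /eps.
by rewrite -mulrA ger_pMr// ler_pdivrMl// mulr1 lerDl.
Unshelve. all: by end_near. Qed.

(** Both ]a, x] and ]x, b] are charged for bringing cos w from near 1 at one end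
    to cos w(x); a and b then tend to the end points. *)
Lemma one_sub_cos_le_energy u w (x : R) : H1r0 u ->
  continuous_representative u w -> w 0 = 0 -> w 1 = 0 ->
  (energy u < +oo)%E -> 0 < x < 1 ->
  2 * (1 - cos (w x)) <= fine (energy u).
Proof.
move=> [mu1 wu _ _ _] uw w0 w1 Efin /andP[x0 x1].
have [cw aeuw] := uw.
set g := weak_derivative u.
have ug : is_weak_derivative u g by exact: xgetPex.
have [[mu_ _ _] [mg _ _] _] := ug.
have wg : antiderivative w g := weak_derivative_antiderivative ug uw.
have mD := measurable_energy_density mu_ mg.
have EE : energy u = (\int[mu]_(r in `]0%R, 1%R[) (energy_density u g r)%:E)%E.
  pose F (r : R) : R := (g r ^+ 2 + sin (u r) ^+ 2 / r ^+ 2) * r.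
  have mF : measurable_fun (`]0, 1[%classic : set R) F.
    rewrite (_ : F = fun r => 2 * energy_density u g r).
      exact: measurable_funM.
    by apply/funext => r; rewrite /energy_density mulrA divff// mul1r.
  rewrite /energy integral_itv_bndoo; last exact/measurable_EFinP.
  rewrite -ge0_integralZl_EFin//; last exact/measurable_EFinP.
  move=> r /=; rewrite in_itv/= => /andP[r0 _].
  have := energy_density_ge0 u g (ltW r0).
  by rewrite lee_fin /energy_density pmulr_rge0.
have E0 : (0 <= energy u)%E.
  rewrite EE integral_ge0// => r /=; rewrite in_itv/= => /andP[r0 _].
  by rewrite lee_fin energy_density_ge0// ltW.
have Ef : energy u \is a fin_num by rewrite ge0_fin_numE.
have key a b : 0 < a -> a < x -> x < b -> b < 1 ->
    `|cos (w x) - cos (w a)| + `|cos (w b) - cos (w x)| <= fine (energy u).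
  move=> a0 ax xb b1; have [ax' xb'] := (ltW ax, ltW xb); rewrite -lee_fin fineK// EE EFinD.
  have sub : `]a, b]%classic `<=` (`]0, 1[%classic : set R).
    by apply: subset_itv; rewrite bnd_simp// ltW.
  apply: (@le_trans _ _ (\int[mu]_(r in `]a, b]) (energy_density u g r)%:E)%E).
    rewrite (@itv_bndbnd_setU _ _ _ (BRight x)) ?bnd_simp//.
    rewrite ge0_integral_setU//=; first last.
    + by apply/disj_setPLR => t /=; rewrite !in_itv/= => /andP[_ tx] /negP; rewrite ltNge tx.
    + move=> t tab; have : `]a, b]%classic t.
        by rewrite (@itv_bndbnd_setU _ _ _ (BRight x)) ?bnd_simp.
      move=> /sub /=; rewrite in_itv/= => /andP[t0 _].
      by rewrite lee_fin energy_density_ge0// ltW.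
    + rewrite -itv_bndbnd_setU ?bnd_simp//; apply/measurable_EFinP.
      exact: measurable_funS mD.
    by apply: leeD; apply: cos_increment_le => //; exact: lt_trans b1.
  apply: ge0_subset_integral => //; first exact/measurable_EFinP.
  move=> r /=; rewrite in_itv/= => /andP[r0 _].
  by rewrite lee_fin energy_density_ge0// ltW.
have [_ c0 c1] := (continuous_within_itvP w ltr01).1 cw.
have cc : cos y @[y --> (0:R)] --> (1:R).
  by rewrite -cos0; exact: continuous_cos.
rewrite w0 in c0; rewrite w1 in c1.
have d0 : cos (w t) @[t --> (0:R)^'+] --> (1:R) by apply: cvg_comp cc.
have d1 : cos (w t) @[t --> (1:R)^'-] --> (1:R) by apply: cvg_comp cc.
apply/ler_addgt0Pr => eps eps0.
have e2 : 0 < eps / 2 by rewrite divr_gt0.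
near (0:R)^'+ => a.
near (1:R)^'- => b.
have ca : `|1 - cos (w a)| <= eps / 2.
  by near: a; move/cvgrPdist_le : d0; exact.
have cb : `|1 - cos (w b)| <= eps / 2.
  by near: b; move/cvgrPdist_le : d1; exact.
have k : `|cos (w x) - cos (w a)| + `|cos (w b) - cos (w x)| <= fine (energy u).
  by apply: key; [near: a; exact: nbhs_right_gt|near: a; exact: nbhs_right_lt|
    near: b; exact: nbhs_left_gt|near: b; exact: nbhs_left_lt].
have := ler_norm (cos (w b) - cos (w x)).
have := ler_norm (- (cos (w x) - cos (w a))); rewrite normrN.
move: ca cb; rewrite !ler_norml => /andP[_ ?] /andP[_ ?]; lra.
Unshelve. all: by end_near. Qed.

(** The hypothesis E <= 2 makes cos w >= 0, which confines |w| to [0, pi/2] by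
    continuity. *)
Lemma norm_le_asin w (E : R) :
  {within `[0, 1], continuous w} -> w 0 = 0 -> w 1 = 0 ->
  0 <= E <= 2 ->
  (forall x : R, 0 < x < 1 -> 2 * (1 - cos (w x)) <= E) ->
  forall x : R, 0 <= x <= 1 -> `|w x| <= 2 * asin (Num.sqrt (2^-1 * E)).
Proof.
move=> cw w0 w1 /andP[E0 E2] wE x /andP[x0 x1].
have {}wE (t : R) : 0 <= t <= 1 -> 2 * (1 - cos `|w t|) <= E.
  rewrite cos_norm => /andP[]; rewrite le_eqVlt => /predU1P[<- _|t0].
    by rewrite w0 cos0 subrr mulr0.
  rewrite le_eqVlt => /predU1P[->|t1]; first by rewrite w1 cos0 subrr mulr0.
  by apply: wE; rewrite t0.
have pi0 := pi_gt0 R.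
have wpi : `|w x| <= pi / 2.
  rewrite leNgt; apply/negP => wx.
  (* A value of |w| beyond pi / 2 but not beyond pi, where cos is negative. *)
  pose y := Num.min `|w x| pi.
  have ypi : y <= pi by rewrite ge_min lexx orbT.
  have yw : y <= `|w x| by rewrite ge_min lexx.
  have y2 : pi / 2 < y by rewrite lt_min wx/=; lra.
  have cn : {within `[0, x], continuous (fun t => `|w t|)}.
    have cw' : {within `[0, x], continuous w}.
      apply: continuous_subspaceW cw; apply: subset_itv; by rewrite bnd_simp.
    by move=> t; apply: cvg_norm; exact: cw'.
  have [|c cx cy] := @IVT _ _ 0 x y x0 cn.
    rewrite w0 normr0 min_l// max_r// yw andbT; lra.
  have : 2 * (1 - cos `|w c|) <= E.
    by apply: wE; move: cx; rewrite in_itv/= => /andP[-> /le_trans]; apply.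
  have : 0 < sin (y - pi / 2) by apply: sin_gt0_pi; lra.
  have := cosDpihalf (y - pi / 2); rewrite subrK cy; lra.
pose th : R := `|w x| / 2.
have th0 : 0 <= th by rewrite divr_ge0.
have : 2 * (1 - cos (th *+ 2)) <= E.
  rewrite (_ : th *+ 2 = `|w x|); last by rewrite mulr2n /th; lra.
  by apply: wE; rewrite x0.
rewrite cos_mulr2n mulr2n => hE.
have cs := cos2Dsin2 th.
have s2 : sin th ^+ 2 <= 2^-1 * E by have := sqr_ge0 (sin th); lra.
have thpi : th <= pi / 2 by rewrite /th; lra.
have sth : sin th <= Num.sqrt (2^-1 * E).
  have st0 : 0 <= sin th by apply: sin_ge0_pi; rewrite th0/=; lra.
  by rewrite -(ger0_norm st0) -sqrtr_sqr ler_wsqrtr.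
have q1 : -1 <= Num.sqrt (2^-1 * E) <= 1.
  apply/andP; split; first by apply: le_trans (sqrtr_ge0 _); lra.
  by rewrite -[leRHS]sqrtr1 ler_wsqrtr//; lra.
rewrite (_ : `|w x| = 2 * th); last by rewrite /th mulrC divfK.
rewrite ler_pM2l// leNgt; apply/negP => h.
move: sth; rewrite leNgt => /negP; apply.
rewrite -[X in X < _]asinK; last by rewrite in_itv.
rewrite ltr_sin// in_itv/=.
  by rewrite asin_geNpi2// asin_lepi2.
rewrite thpi andbT; lra.
Qed.

End energy.

Theorem lemma2p1 (R : realType) (u : R -> R) (hu : energy_sublevel 1 u) :
  (norm_Linfty u <=
     (2 * asin (Num.sqrt (2^-1 * fine (energy u))))%:E)%E.
Proof.
have [Hu E2] := hu.
have [_ _ _ _ [w [uw w0 w1]]] := Hu.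
have E0 : (0 <= energy u)%E.
  rewrite /energy mule_ge0// integral_ge0// => r /=; rewrite in_itv/= => /andP[r0 _].
  have := energy_density_ge0 u (weak_derivative u) r0.
  by rewrite lee_fin /energy_density pmulr_rge0.
have Elt : (energy u < +oo)%E by apply: le_lt_trans E2 _; rewrite ltry.
have Ef : energy u \is a fin_num by rewrite ge0_fin_numE.
have bound : forall x, 0 <= x <= 1 ->
    `|w x| <= 2 * asin (Num.sqrt (2^-1 * fine (energy u))).
  apply: (norm_le_asin uw.1 w0 w1) => //.
    rewrite fine_ge0//= -lee_fin fineK//; by rewrite mulr1 in E2.
  by move=> x; exact: one_sub_cos_le_energy Hu uw w0 w1 Elt.
have bound0 := bound 0; rewrite lexx ler01 w0 normr0 in bound0.
rewrite /norm_Linfty unlock; case: ifPn => _; last exact: bound0.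
apply/ess_supP.
have [N [mN N0 subN]] := uw.2.
(* The complement of [0, 1] is null for the restricted measure. *)
exists (N `|` ~` `[0, 1]%classic); split.
- by apply: measurableU => //; exact: measurableC.
- rewrite -[LHS]/(lebesgue_measure ((N `|` ~` `[0, 1]) `&` `[0, 1])) setIUl.
  rewrite setICl setU0; apply: subset_measure0 N0 => //.
  exact: measurableI.
move=> x /= nux; have [x01|] := pselect (`[0, 1]%classic x); last by right.
left; apply: subN => /= /(_ x01) uwx; apply: nux; rewrite uwx lee_fin.
by apply: bound; move: x01; rewrite /= in_itv.
Qed.
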